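(* Let $n\ge 3$, let $\Omega\subset\mathbb{R}^n$ be a bounded domain with smooth boundary, let $0<\gamma<\frac{n+2}{n-2}$, and assume that $0<\sigma<\min\left\{\frac13,\frac{n+2-(n-2)\gamma}{2}\right\}$. Then there is a constant $C>0$ such that $$\|u\|_{L^2(\Omega)}\le C\|u\|_{L^{\frac{2n(n-2)}{n(n-4-2\sigma)+4(1+3\sigma)}}(\Omega)}\le C\|u\|_{L^{\frac{2n}{n-2-2\sigma}}(\Omega)}$$ for all $u\in L^{\frac{2n}{n-2-2\sigma}}(\Omega)$, and $$\|u\|_{L^{\frac{2n\gamma}{n+2-2\sigma}}(\Omega)}\le C\|u\|_{L^{\frac{2n}{n-2}}(\Omega)}\le C\|\nabla u\|_{L^2(\Omega)}$$ for all $u\in H_0^1(\Omega)$.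
   Context: $C$ denotes a generic positive constant, independent of $u$, whose value may differ at each occurrence. For exponents $q\in(0,1)$, $\|u\|_{L^q(\Omega)}$ denotes $(\int_\Omega|u|^q dx)^{1/q}$. *)

(* Defs.v *)
From HB Require Import structures.
From mathcomp Require Import all_boot all_order all_algebra.
From mathcomp Require Import all_classical all_reals all_analysis.

Set Implicit Arguments.
Unset Strict Implicit.
Unset Printing Implicit Defensive.
Import Order.TTheory GRing.Theory Num.Theory.
Import numFieldNormedType.Exports.

Local Open Scope classical_set_scope.
Local Open Scope ring_scope.

(* The Euclidean space R^n is 'rV[R]_n.  It carries the product sigma-algebra,
   generated by the coordinate maps, as n.-tuple R does in the library. *)
Definition rV_display : measure_display.
Proof. by constructor. Qed.

Section rV_measurable.
Variables (R : realType) (n : nat).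

Definition rV_coord (i : 'I_n) (x : 'rV[R]_n) : measurableTypeR R := x ord0 i.

Let rV_set0 : g_sigma_preimage rV_coord set0.
Proof. exact: sigma_algebra0. Qed.

Let rV_setC A : g_sigma_preimage rV_coord A -> g_sigma_preimage rV_coord (~` A).
Proof. exact: sigma_algebraC. Qed.

Let rV_bigcup (F : (set 'rV[R]_n)^nat) :
  (forall i, g_sigma_preimage rV_coord (F i)) ->
  g_sigma_preimage rV_coord (\bigcup_i (F i)).
Proof. exact: sigma_algebra_bigcup. Qed.

HB.instance Definition _ := @isMeasurable.Build rV_display 'rV[R]_n
  (g_sigma_preimage rV_coord) rV_set0 rV_setC rV_bigcup.

Lemma measurable_rV_coord i : measurable_fun [set: 'rV[R]_n] (rV_coord i).
Proof.
move=> _ Y mY; rewrite setTI; apply: sub_sigma_algebra => /=.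
rewrite -bigcup_seq/=; exists i => /=; first by rewrite mem_index_enum.
by exists Y => //; rewrite setTI.
Qed.

Lemma measurable_fun_rVP d (T : measurableType d) (f : T -> 'rV[R]_n) :
  (forall i, measurable_fun setT (rV_coord i \o f)) -> measurable_fun setT f.
Proof.
move=> mf; have : g_sigma_preimage (fun i => rV_coord i \o f) `<=` measurable.
  apply: smallest_sub; first exact: sigma_algebra_measurable.
  move=> A; rewrite -bigcup_seq => -[i _ [B mB <-]]; exact: mf.
by rewrite g_sigma_preimage_comp => prefS _ A mA; apply: prefS; exists A.
Qed.

End rV_measurable.

Section rV_lebesgue.
Variable R : realType.

Definition rV_cons (n : nat) (p : measurableTypeR R * 'rV[R]_n) : 'rV[R]_n.+1 :=
  row_mx (const_mx p.1 : 'rV[R]_1) p.2.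

Lemma measurable_rV_cons n : measurable_fun setT (@rV_cons n).
Proof.
apply: measurable_fun_rVP => i.
have [j ->|j ->] := split_ordP (i : 'I_(1 + n)).
- rewrite (_ : _ \o _ = fst); first exact: measurable_fst.
  by apply/funext => p; rewrite /= /rV_coord [LHS]row_mxEl mxE.
- rewrite (_ : _ \o _ = rV_coord j \o snd); last first.
    by apply/funext => p; rewrite /= /rV_coord [LHS]row_mxEr.
  by apply: measurableT_comp; [exact: measurable_rV_coord|exact: measurable_snd].
Qed.

Section cons_measure.
Variables (n : nat) (m : {sigma_finite_measure set 'rV[R]_n -> \bar R}).

Definition cons_measure : set 'rV[R]_n.+1 -> \bar R :=
  pushforward (@lebesgue_measure R \x m)%E (@rV_cons n).

Let mT A : measurable A -> measurable (@rV_cons n @^-1` A).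
Proof. by move=> mA; rewrite -[X in measurable X]setTI; exact: measurable_rV_cons. Qed.

Let cons_measure0 : cons_measure set0 = 0%E.
Proof. by rewrite /cons_measure /pushforward preimage_set0 measure0. Qed.

Let cons_measure_ge0 A : (0 <= cons_measure A)%E.
Proof. by rewrite /cons_measure /pushforward; exact: measure_ge0. Qed.

Let cons_measure_sigma_additive : semi_sigma_additive cons_measure.
Proof.
move=> F mF tF mUF; rewrite /cons_measure /pushforward preimage_bigcup.
apply: measure_semi_sigma_additive.
- by move=> k; exact: mT.
- apply/trivIsetP => /= i j _ _ ij; rewrite -preimage_setI.
  by move/trivIsetP : tF => /(_ _ _ _ _ ij) ->//; rewrite preimage_set0.
- by rewrite -preimage_bigcup; exact: mT.
Qed.

HB.instance Definition _ := isMeasure.Build _ _ _ cons_measure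
  cons_measure0 cons_measure_ge0 cons_measure_sigma_additive.

Let uncons (x : 'rV[R]_n.+1) : measurableTypeR R * 'rV[R]_n :=
  (rV_coord ord0 x, \row_j x ord0 (lift ord0 j)).

Let unconsK : cancel (@rV_cons n) uncons.
Proof.
move=> [a x]; rewrite /uncons /rV_coord; congr pair.
  rewrite (_ : ord0 = lshift n (ord0 : 'I_1)); last exact: val_inj.
  by rewrite [LHS]row_mxEl mxE.
apply/rowP => j; rewrite mxE.
rewrite (_ : lift ord0 j = rshift 1 j); last exact: val_inj.
by rewrite [LHS]row_mxEr.
Qed.

Let measurable_uncons : measurable_fun setT uncons.
Proof.
apply: measurable_fun_pair; first exact: measurable_rV_coord.
apply: measurable_fun_rVP => i.
rewrite (_ : _ \o _ = rV_coord (lift ord0 i)); first exact: measurable_rV_coord.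
by apply/funext => x; rewrite /= /rV_coord mxE.
Qed.

Let cons_measure_sigma_finite : sigma_finite setT cons_measure.
Proof.
have [F TF Foo] : sigma_finite setT (@lebesgue_measure R \x m)%E.
  have /sigma_finiteP[F [TF ndF Foo]] := sigma_finiteT (@lebesgue_measure R).
  have /sigma_finiteP[G [TG ndG Goo]] := sigma_finiteT m.
  exists (fun k => F k `*` G k).
    rewrite -setXTT TF TG predeqE => -[x y]; split.
      move=> [/= [i _ Fix] [j _ Gjy]]; exists (maxn i j) => //; split.
      - by move: x Fix; exact/subsetPset/ndF/leq_maxl.
      - by move: y Gjy; exact/subsetPset/ndG/leq_maxr.
    by move=> [i _ []/= ? ?]; split; exists i.
  move=> k; have [? ?] := Foo k; have [? ?] := Goo k.
  split; first exact: measurableX.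
  by rewrite product_measure1E// lte_mul_pinfty// ge0_fin_numE.
exists (fun k => uncons @^-1` F k).
  by rewrite -preimage_bigcup -TF preimage_setT.
move=> k; have [mF Fk] := Foo k; split.
  by rewrite -[X in measurable X]setTI; exact: measurable_uncons.
rewrite /cons_measure /pushforward -comp_preimage.
rewrite (_ : uncons \o @rV_cons n = id) ?preimage_id//.
by apply/funext => p /=; rewrite unconsK.
Qed.

HB.instance Definition _ := Measure_isSigmaFinite.Build _ _ _ cons_measure
  cons_measure_sigma_finite.

End cons_measure.

(* Lebesgue measure on R^n, by induction on n: the product of the Lebesgue
   measure on R with that on R^n, transported along rV_cons. *)
Fixpoint lebesgue_rV (n : nat) : {sigma_finite_measure set 'rV[R]_n -> \bar R} :=
  match n with
  | 0 => \d_(0 : 'rV[R]_0)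
  | k.+1 => cons_measure (lebesgue_rV k)
  end.

End rV_lebesgue.

Lemma lebesgue_rV_box (R : realType) n (A : 'I_n -> set (measurableTypeR R)) :
  (forall i, measurable (A i)) ->
  lebesgue_rV R n [set x : 'rV[R]_n | forall i, A i (x ord0 i)] =
  (\prod_(i < n) lebesgue_measure (A i))%E.
Proof.
elim: n A => [|n IH] A mA.
  by rewrite big_ord0 /= diracE mem_set //=; case.
rewrite big_ord_recl /= /cons_measure /pushforward.
pose B := [set x : 'rV[R]_n | forall i, A (lift ord0 i) (x ord0 i)].
have E0 (a : R) (x : 'rV[R]_n) : rV_cons (a, x) ord0 ord0 = a.
  rewrite (_ : ord0 = lshift n (ord0 : 'I_1)); last exact: val_inj.
  by rewrite [LHS]row_mxEl mxE.
have EL (a : R) (x : 'rV[R]_n) j : rV_cons (a, x) ord0 (lift ord0 j) = x ord0 j.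
  rewrite (_ : lift ord0 j = rshift 1 j); last exact: val_inj.
  by rewrite [LHS]row_mxEr.
have -> : rV_cons (n:=n) @^-1` [set x | forall i, A i (x ord0 i)] = A ord0 `*` B.
  apply/seteqP; split=> [[a x] /= H|[a x] /= [H0 H] i].
    by split=> [|i]; [have := H ord0; rewrite E0|have := H (lift ord0 i); rewrite EL].
  by case: (unliftP ord0 i) => [j|] ->; rewrite ?E0 ?EL//; exact: H.
rewrite product_measure1E //; first by congr (_ * _)%E; exact: IH.
rewrite (_ : B = \big[setI/setT]_(i < n) (@rV_coord R n i @^-1` A (lift ord0 i))).
  apply: bigsetI_measurable => i _; rewrite -[X in measurable X]setTI.
  exact: measurable_rV_coord.
apply/seteqP; split => x /=.
  by rewrite -bigcap_seq => H i _; exact: H.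
by rewrite -bigcap_seq => H i; apply: (H i); rewrite /= mem_index_enum.
Qed.

Section differential.
Variables (R : realType) (n : nat).
Implicit Types (f : 'rV[R]_n -> R) (x : 'rV[R]_n).

Definition unit_vec (i : 'I_n) : 'rV[R]_n := delta_mx ord0 i.

Definition partial (i : 'I_n) f : 'rV[R]_n -> R := 'D_(unit_vec i) f.

Definition gradient f (x : 'rV[R]_n) : 'rV[R]_n := \row_i partial i f x.

(* The norm of 'rV[R]_n in the library is the sup norm. *)
Definition euclid_norm x : R := Num.sqrt (\sum_i x ord0 i ^+ 2).

(* C^oo functions: the iterated partial derivatives of all orders exist
   everywhere and are continuous. *)
Definition smooth f := forall s : seq 'I_n,
  continuous (foldr partial f s) /\
  forall (i : 'I_n) x, derivable (foldr partial f s) x (unit_vec i).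

End differential.

Section domains.
Variables (R : realType) (n : nat).
Implicit Types (Omega : set 'rV[R]_n).

Definition bounded_domain Omega :=
  [/\ Omega !=set0, open Omega, connected Omega & bounded_set Omega].

(* Near each boundary point, and for a suitable coordinate i, Omega is the
   strict epigraph or hypograph of a smooth function of the other coordinates. *)
Definition smooth_boundary Omega := forall x0, (closure Omega `\` interior Omega) x0 ->
  exists (i : 'I_n) (h : 'rV[R]_n.-1 -> R), smooth h /\
    ((\forall x \near x0, Omega x <-> h (col' i x) < x ord0 i) \/
     (\forall x \near x0, Omega x <-> x ord0 i < h (col' i x))).

End domains.

Section function_spaces.
Variables (R : realType) (n : nat) (Omega : set 'rV[R]_n).
Implicit Types (u phi : 'rV[R]_n -> R) (G : 'rV[R]_n -> 'rV[R]_n).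

Local Notation mu := (lebesgue_rV R n).

(* A function on Omega is a function on R^n of which only the values on Omega
   matter.  The exponent q may be any positive real, possibly smaller than 1. *)
Definition Lq (q : R) u := u \_ Omega \in Lfun mu q%:E.

Definition Lq_norm (q : R) u : \bar R := 'N[mu]_(q%:E)[EFin \o u \_ Omega].

Definition test_function phi := smooth phi /\
  exists K, [/\ compact K, K `<=` Omega & forall x, ~ K x -> phi x = 0].

Definition weak_gradient u G := forall (i : 'I_n) phi, test_function phi ->
  (\int[mu]_(x in Omega) (u x * partial i phi x)%:E =
   - \int[mu]_(x in Omega) (G x ord0 i * phi x)%:E)%E.

(* u belongs to H^1(Omega) = W^{1,2}(Omega), with weak gradient G. *)
Definition H1 u G :=
  [/\ Lq 2 u, forall i, Lq 2 (fun x => G x ord0 i) & weak_gradient u G].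

Definition H1_norm u G : \bar R :=
  ((Lq_norm 2 u `^ 2 + Lq_norm 2 (fun x => euclid_norm (G x)) `^ 2) `^ 2^-1)%E.

(* u belongs to the closure H^1_0(Omega) of the test functions in H^1(Omega),
   with weak gradient G. *)
Definition H10 u G := H1 u G /\
  forall e : R, 0 < e -> exists phi, test_function phi /\
    (H1_norm (fun x => u x - phi x)%R (fun x => G x - gradient phi x)%R < e%:E)%E.

End function_spaces.

(* Main.v *)
Require Import Defs.
From HB Require Import structures.
From mathcomp Require Import all_boot all_order all_algebra.
From mathcomp Require Import all_classical all_reals all_analysis.
From mathcomp Require Import measurable_realfun ring lra.

Set Implicit Arguments.
Unset Strict Implicit.
Unset Printing Implicit Defensive.
Import Order.TTheory GRing.Theory Num.Theory.
Import numFieldNormedType.Exports.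

Local Open Scope classical_set_scope.
Local Open Scope ring_scope.

(* On a set of finite measure, Hölder's inequality bounds the L^p norm by the L^q
   norm whenever 0 < p < q.  The range of sigma makes all the exponents involved
   strictly ordered.

   For Sobolev's inequality, Gagliardo's lemma says that if u is bounded, at every
   point and in every direction i, by the integral of g_i along the line through
   that point parallel to the i-th axis, then
     \int u^(n/(n-1)) <= \prod_i (\int g_i)^(1/(n-1)).
   It is applied to u = |phi|^s with s = 2(n-1)/(n-2) and
   g_i = s |phi|^(s-1) |d_i phi|: since s n/(n-1) = 2(s-1) = 2n/(n-2), bounding
   \int g_i by Cauchy-Schwarz and absorbing the power of the norm of phi gives the
   inequality for a test function phi.  It passes to H^1_0 because the L^q norm
   is lower semicontinuous with respect to convergence in L^2. *)

(** * Hölder's inequality for extended-real functions *)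

Section ereal_hoelder.
Context d (T : measurableType d) (R : realType).
Variable mu : {measure set T -> \bar R}.
Local Open Scope ereal_scope.
Implicit Types (f g : T -> \bar R) (a b : R).

Lemma measurable_fun_poweR f a : measurable_fun setT f ->
  measurable_fun setT (fun x => f x `^ a).
Proof.
move=> mf; apply: (@measurableT_comp _ _ _ _ _ _ (poweR ^~ a)) => //.
exact: measurable_poweR.
Qed.

Lemma measurable_fun_fine f : measurable_fun setT f ->
  measurable_fun setT (fun x => fine (f x)).
Proof.
by move=> mf; apply: (@measurableT_comp _ _ _ _ _ _ (@fine R)).
Qed.

Lemma ge0_integral_eq0_ae f : measurable_fun setT f -> (forall x, 0 <= f x) ->
  \int[mu]_x f x = 0 -> f = cst 0 %[ae mu].
Proof.
move=> mf f0 If; apply/ae_eq_integral_abs => //.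
by rewrite -{}[RHS]If; apply: eq_integral => x _; rewrite gee0_abs.
Qed.

Lemma ge0_lty_integral_ae f : measurable_fun setT f -> (forall x, 0 <= f x) ->
  \int[mu]_x f x < +oo -> {ae mu, forall x, f x \is a fin_num}.
Proof.
move=> mf f0 If; have fi : mu.-integrable setT f.
  apply/integrableP; split => //.
  by under eq_integral do rewrite gee0_abs//.
by apply: filterS (integrable_ae measurableT fi) => x; exact.
Qed.

Lemma le_integral_fine f : measurable_fun setT f -> (forall x, 0 <= f x) ->
  \int[mu]_x (fine (f x))%:E <= \int[mu]_x f x.
Proof.
move=> mf f0; apply: ge0_le_integral => //.
- by move=> x _; rewrite lee_fin fine_ge0.
- by apply/measurable_EFinP; exact: measurable_fun_fine.
- by move=> x _; have := f0 x; case: (f x).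
Qed.

(** Once the cases of a zero or infinite integral are settled, [f] and [g] are finite almost
    everywhere. They can then be replaced by real functions, to which Hölder's inequality applies
    with the conjugate exponents [1/a] and [1/b]. *)
Lemma ereal_hoelder_pos f g a b : measurable_fun setT f -> measurable_fun setT g ->
  (forall x, 0 <= f x) -> (forall x, 0 <= g x) ->
  (0 < a)%R -> (0 < b)%R -> (a + b = 1)%R ->
  \int[mu]_x (f x `^ a * g x `^ b) <=
    (\int[mu]_x f x) `^ a * (\int[mu]_x g x) `^ b.
Proof.
move=> mf mg f0 g0 a0 b0 ab.
have mfg : measurable_fun setT (fun x => f x `^ a * g x `^ b).
  by apply: emeasurable_funM; exact: measurable_fun_poweR.
have If0 : 0 <= \int[mu]_x f x by exact: integral_ge0.
have Ig0 : 0 <= \int[mu]_x g x by exact: integral_ge0.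
have pg0 h c : 0 <= h `^ c :> \bar R by exact: poweR_ge0.
have [f00|fN0] := eqVneq (\int[mu]_x f x) 0.
  rewrite (ae_eq_integral (cst 0)) ?integral0 ?mule_ge0//.
  apply: filterS (ge0_integral_eq0_ae mf f0 f00) => x /(_ I) /= -> _.
  by rewrite poweR0r ?gt_eqF// mul0e.
have [g00|gN0] := eqVneq (\int[mu]_x g x) 0.
  rewrite (ae_eq_integral (cst 0)) ?integral0 ?mule_ge0//.
  apply: filterS (ge0_integral_eq0_ae mg g0 g00) => x /(_ I) /= -> _.
  by rewrite poweR0r ?gt_eqF// mule0.
have [foo|fNoo] := eqVneq (\int[mu]_x f x) +oo.
  by rewrite foo poweRyr ?gt_eqF// gt0_mulye ?leey// poweR_gt0// lt0e gN0.
have [goo|gNoo] := eqVneq (\int[mu]_x g x) +oo.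
  by rewrite goo poweRyr ?gt_eqF// gt0_muley ?leey// poweR_gt0// lt0e fN0.
pose F x := (fine (f x) `^ a)%R; pose G x := (fine (g x) `^ b)%R.
have mF : measurable_fun setT F.
  apply: (@measurableT_comp _ _ _ _ _ _ (@powR R ^~ a)) => //.
  exact: measurable_fun_fine.
have mG : measurable_fun setT G.
  apply: (@measurableT_comp _ _ _ _ _ _ (@powR R ^~ b)) => //.
  exact: measurable_fun_fine.
have F0 x : (0 <= F x)%R by exact: powR_ge0.
have G0 x : (0 <= G x)%R by exact: powR_ge0.
have -> : \int[mu]_x (f x `^ a * g x `^ b) = 'N[mu]_1[EFin \o (F \* G)%R].
  rewrite Lnorm1; apply: ae_eq_integral => //.
    apply/measurableT_comp => //; apply/measurable_EFinP.
    exact: measurable_funM.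
  have := ge0_lty_integral_ae mf f0; rewrite ltey => /(_ fNoo).
  have := ge0_lty_integral_ae mg g0; rewrite ltey => /(_ gNoo).
  apply: filterS2 => x gx fx _ /=.
  rewrite ger0_norm ?mulr_ge0// EFinM /F /G -!poweR_EFin.
  by rewrite !fineK.
have NE h c : (0 < c)%R -> measurable_fun setT h -> (forall x, 0 <= h x) ->
    'N[mu]_(c^-1)%:E[EFin \o (fun x => fine (h x) `^ c)%R] <=
    (\int[mu]_x h x) `^ c.
  move=> c0 mh h0; rewrite unlock invrK.
  apply: (gt0_ler_poweR (ltW c0)); rewrite ?in_itv/= ?leey ?andbT.
  - by apply: integral_ge0 => x _; rewrite lee_fin powR_ge0.
  - exact: integral_ge0.
  (* Since [fine] sends [+oo] to 0, it can only decrease the integral, and this is the favourable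
     direction. *)
  apply: le_trans (le_integral_fine mh h0).
  under eq_integral => x _.
    rewrite /= ger0_norm ?powR_ge0// -powRrM mulfV ?gt_eqF// powRr1 ?fine_ge0//.
    over.
  exact: lexx.
apply: le_trans (hoelder mu mF mG _ _ _) _; last 1 first.
  by apply: lee_pmul; rewrite ?Lnorm_ge0//; exact: NE.
- by rewrite invr_gt0.
- by rewrite invr_gt0.
- by rewrite !invrK.
Qed.

End ereal_hoelder.

(** * Hölder's inequality for several factors *)

Section prod_hoelder.
Context (R : realType).
Local Open Scope ereal_scope.

Lemma poweR_prod (I : Type) (s : seq I) (F : I -> \bar R) (a : R) :
  (forall i, 0 <= F i) -> (\prod_(i <- s) F i) `^ a = \prod_(i <- s) F i `^ a.
Proof.
move=> F0; elim: s => [|i s IH]; first by rewrite !big_nil poweR1r.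
by rewrite !big_cons poweRM ?IH//; apply: prode_ge0.
Qed.

Lemma emeasurable_prod d (T : measurableType d) (I : Type) (s : seq I)
    (F : I -> T -> \bar R) : (forall i, measurable_fun setT (F i)) ->
  measurable_fun setT (fun x => \prod_(i <- s) F i x).
Proof.
move=> mF; elim: s => [|i s IH].
  by under eq_fun do rewrite big_nil; exact: measurable_cst.
by under eq_fun do rewrite big_cons; exact: emeasurable_funM.
Qed.

(** Induction on the number of factors: the first is split off with weight [1/(m+2)]. The others
    share the weight [(m+1)/(m+2)] and are left to the induction hypothesis, with exponent [1/(m+1)]
    each. *)
Lemma ereal_hoelder_prod d (T : measurableType d) (mu : {measure set T -> \bar R})
    (m : nat) (h : 'I_m.+1 -> T -> \bar R) :
  (forall i, measurable_fun setT (h i)) -> (forall i x, 0 <= h i x) ->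
  \int[mu]_x \prod_(i < m.+1) h i x `^ m.+1%:R^-1 <=
    \prod_(i < m.+1) (\int[mu]_x h i x) `^ m.+1%:R^-1.
Proof.
elim: m h => [|m IH] h mh h0.
  rewrite big_ord1 invr1 poweRe1; last exact: integral_ge0.
  by under eq_integral do rewrite big_ord1 poweRe1//.
pose a : R := (m.+2%:R^-1)%R; pose b : R := (m.+1%:R / m.+2%:R)%R.
have a0 : (0 < a)%R by rewrite invr_gt0.
have b0 : (0 < b)%R by rewrite divr_gt0.
have ab : (a + b = 1)%R.
  by rewrite /a /b -[X in (X + _)%R]mul1r -mulrDl nat1r divff// pnatr_eq0.
have split_exp (H : 'I_m.+2 -> \bar R) : (forall i, 0 <= H i) ->
    \prod_(i < m.+2) H i `^ a =
    H ord0 `^ a * (\prod_(i < m.+1) H (lift ord0 i) `^ m.+1%:R^-1) `^ b.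
  move=> H0; rewrite big_ord_recl poweR_prod; last by move=> i; exact: poweR_ge0.
  congr (_ * _).
  apply: eq_bigr => i _; rewrite -poweRrM; congr (_ `^ _).
  by rewrite /b mulrA mulVf ?mul1r// pnatr_eq0.
under eq_integral do rewrite split_exp//.
rewrite split_exp; last by move=> i; exact: integral_ge0.
apply: le_trans (ereal_hoelder_pos mu _ _ _ _ a0 b0 ab) _ => //.
- by apply: emeasurable_prod => i; exact: measurable_fun_poweR.
- by move=> x; apply: prode_ge0 => i _; exact: poweR_ge0.
apply: lee_wpmul2l; first exact: poweR_ge0.
apply: (gt0_ler_poweR (ltW b0)); rewrite ?in_itv/= ?leey ?andbT.
- by apply: integral_ge0 => x _; apply: prode_ge0 => i _; exact: poweR_ge0.
- by apply: prode_ge0 => i _; exact: poweR_ge0.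
exact: IH.
Qed.

End prod_hoelder.

(** * Gagliardo's lemma *)

Section rV_fubini.
Context (R : realType).
Local Open Scope ereal_scope.
Notation mu := (lebesgue_rV R).

(** As [s] varies, this runs over the line through [x] parallel to the [i]-th axis. *)
Definition upd n (i : 'I_n) (s : R) (x : 'rV[R]_n) : 'rV[R]_n :=
  \row_j (if j == i then s else x ord0 j).

Lemma rV_cons0 n (t : R) (y : 'rV[R]_n) : rV_cons (t, y) ord0 ord0 = t.
Proof.
rewrite (_ : ord0 = lshift n (ord0 : 'I_1)); last exact: val_inj.
by rewrite [LHS]row_mxEl mxE.
Qed.

Lemma rV_consS n (t : R) (y : 'rV[R]_n) j :
  rV_cons (t, y) ord0 (lift ord0 j) = y ord0 j.
Proof.
rewrite (_ : lift ord0 j = rshift 1 j); last exact: val_inj.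
by rewrite [LHS]row_mxEr.
Qed.

Lemma upd_cons0 n (s t : R) (y : 'rV[R]_n) :
  upd ord0 s (rV_cons (t, y)) = rV_cons (s, y).
Proof.
apply/rowP => j; rewrite mxE; case: (unliftP ord0 j) => [k|] ->.
  by rewrite eq_sym (negbTE (neq_lift _ _)) !rV_consS.
by rewrite eqxx rV_cons0.
Qed.

Lemma upd_consS n (i : 'I_n) (s t : R) (y : 'rV[R]_n) :
  upd (lift ord0 i) s (rV_cons (t, y)) = rV_cons (t, upd i s y).
Proof.
apply/rowP => j; rewrite mxE; case: (unliftP ord0 j) => [k|] ->.
  by rewrite (inj_eq lift_inj) !rV_consS mxE.
by rewrite (negbTE (neq_lift _ _)) !rV_cons0.
Qed.

Lemma ge0_integral_rV_cons n (f : 'rV[R]_n.+1 -> \bar R) :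
  measurable_fun setT f -> (forall x, 0 <= f x) ->
  \int[mu n.+1]_x f x = \int[lebesgue_measure \x mu n]_p f (rV_cons p).
Proof.
move=> mf f0.
by rewrite [LHS](ge0_integral_pushforward (@measurable_rV_cons R n)).
Qed.

Lemma measurable_fun_rV_cons n (f : 'rV[R]_n.+1 -> \bar R) :
  measurable_fun setT f -> measurable_fun setT (f \o @rV_cons R n).
Proof. by move=> mf; exact: measurableT_comp mf (@measurable_rV_cons R n). Qed.

(** Both orders of integration serve below: with the first coordinate outside, to work slice by
    slice; with it inside, as in [rV_fubini2], to average over the first coordinate. *)
Lemma rV_fubini1 n (f : 'rV[R]_n.+1 -> \bar R) :
  measurable_fun setT f -> (forall x, 0 <= f x) ->
  \int[mu n.+1]_x f x = \int[lebesgue_measure]_t \int[mu n]_y f (rV_cons (t, y)).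
Proof.
move=> mf f0; rewrite ge0_integral_rV_cons//.
rewrite (fubini_tonelli1 (f \o @rV_cons R n))//.
  exact: measurable_fun_rV_cons.
by move=> x; exact: f0.
Qed.

Lemma rV_fubini2 n (f : 'rV[R]_n.+1 -> \bar R) :
  measurable_fun setT f -> (forall x, 0 <= f x) ->
  \int[mu n.+1]_x f x = \int[mu n]_y \int[lebesgue_measure]_t f (rV_cons (t, y)).
Proof.
move=> mf f0; rewrite ge0_integral_rV_cons//.
rewrite (fubini_tonelli2 (f \o @rV_cons R n))//.
  exact: measurable_fun_rV_cons.
by move=> x; exact: f0.
Qed.

Lemma measurable_rV_fubini1 n (f : 'rV[R]_n.+1 -> \bar R) :
  measurable_fun setT f -> (forall x, 0 <= f x) ->
  measurable_fun setT (fun t => \int[mu n]_y f (rV_cons (t, y))).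
Proof.
move=> mf f0; apply: (measurable_fun_fubini_tonelli_F (f \o @rV_cons R n)).
  exact: measurable_fun_rV_cons.
by move=> x; exact: f0.
Qed.

Lemma measurable_rV_fubini2 n (f : 'rV[R]_n.+1 -> \bar R) :
  measurable_fun setT f -> (forall x, 0 <= f x) ->
  measurable_fun setT (fun y => \int[lebesgue_measure]_t f (rV_cons (t, y))).
Proof.
move=> mf f0; apply: (measurable_fun_fubini_tonelli_G (f \o @rV_cons R n)).
  exact: measurable_fun_rV_cons.
by move=> x; exact: f0.
Qed.

Lemma measurable_rV_cons_slice n (f : 'rV[R]_n.+1 -> \bar R) t :
  measurable_fun setT f -> measurable_fun setT (fun y => f (rV_cons (t, y))).
Proof.
move=> mf.
exact: (measurableT_comp (measurable_fun_rV_cons mf) (measurable_pair1 t)).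
Qed.

End rV_fubini.

Section gagliardo.
Context (R : realType).
Local Open Scope ereal_scope.
Notation mu := (lebesgue_rV R).

(** The bound in direction [i] is an integral over a whole line, hence independent of the [i]-th
    coordinate of [x]. *)
Definition gagliardo_hyp n (u : 'rV[R]_n -> \bar R) (g : 'I_n -> 'rV[R]_n -> \bar R) :=
  [/\ measurable_fun setT u, forall x, 0 <= u x,
      forall i, measurable_fun setT (g i), forall i x, 0 <= g i x &
      forall i x, u x <= \int[lebesgue_measure]_s g i (upd i s x)].

(** Moving a later coordinate commutes with fixing the first one at [t], so a slice inherits the
    bounds in all directions but the first. *)
Lemma gagliardo_slice n u g (t : R) : @gagliardo_hyp n.+1 u g ->
  gagliardo_hyp (fun y => u (rV_cons (t, y)))
                (fun i y => g (lift ord0 i) (rV_cons (t, y))).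
Proof.
case=> mu0 u0 mg g0 H; split => //.
- exact: measurable_rV_cons_slice.
- by move=> i; exact: measurable_rV_cons_slice.
- by move=> i x; under eq_integral do rewrite -(upd_consS _ _ t); exact: H.
Qed.

(* Gagliardo's inequality is proved by induction on the dimension in its dual form,
   against a test weight v: unlike the direct form, this one makes sense in
   dimension 1. *)
Lemma gagliardo_dual1 u g (v : 'rV[R]_1 -> \bar R) : gagliardo_hyp u g ->
  measurable_fun setT v -> (forall x, 0 <= v x) ->
  \int[mu 1%N]_x (u x * v x) <= (\int[mu 1%N]_x g ord0 x) * \int[mu 1%N]_x v x.
Proof.
case=> mu0 u0 mg g0 H mv v0.
rewrite -ge0_integralZl//; last exact: integral_ge0.
apply: ge0_le_integral => //.
- by move=> x _; exact: mule_ge0.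
- exact: emeasurable_funM.
- exact: emeasurable_funM.
move=> x _; apply: lee_wpmul2r => //; apply: le_trans (H ord0 x) _.
(* The space of dimension 0 is a point with a Dirac mass: the inner integral is an evaluation, and
   the line through [x] is the whole space. *)
rewrite rV_fubini1// le_eqVlt; apply/orP; left; apply/eqP.
apply: eq_integral => s _; rewrite integral_dirac//=.
  rewrite diracT mul1e; congr (g _ _).
  by rewrite -(upd_cons0 s (x ord0 ord0) 0); congr upd; apply/rowP => j;
     rewrite (ord1 j) rV_cons0.
exact: measurable_rV_cons_slice.
Qed.

(** Half of the induction: slicing along the first coordinate turns the dual form in dimension [n+1]
    into the direct form in dimension [n+2]. *)
Lemma gagliardo_step n u g :
  (forall u g v, @gagliardo_hyp n.+1 u g ->
    measurable_fun setT v -> (forall x, 0 <= v x) ->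
    \int[mu n.+1]_x (u x * v x `^ n.+1%:R^-1) <=
    \prod_(i < n.+1) (\int[mu n.+1]_x g i x) `^ n.+1%:R^-1 *
      (\int[mu n.+1]_x v x) `^ n.+1%:R^-1) ->
  @gagliardo_hyp n.+2 u g ->
  \int[mu n.+2]_x (u x `^ (1 + n.+1%:R^-1)) <=
    \prod_(i < n.+2) (\int[mu n.+2]_x g i x) `^ n.+1%:R^-1.
Proof.
move=> IH ug; have [mu0 u0 mg g0 H] := ug.
pose a : R := (n.+1%:R^-1)%R.
have a0 : (0 < a)%R by rewrite invr_gt0.
pose G y := \int[lebesgue_measure]_t g ord0 (rV_cons (t, y)).
have mG : measurable_fun setT G by exact: measurable_rV_fubini2.
have G0 y : 0 <= G y by exact: integral_ge0.
(* For fixed t = x_0 apply the dual form to u(t, .) with weight G, using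
   u^(1/n) <= G^(1/n); Hölder's inequality in t then recombines the slices. *)
have uG t y : u (rV_cons (t, y)) <= G y.
  apply: le_trans (H ord0 _) _.
  by rewrite /G; under eq_integral do rewrite upd_cons0.
pose h i t := \int[mu n.+1]_y g (lift ord0 i) (rV_cons (t, y)).
have mh i : measurable_fun setT (h i) by exact: measurable_rV_fubini1.
have h0 i t : 0 <= h i t by exact: integral_ge0.
have IG0 : 0 <= \int[mu n.+1]_y G y by exact: integral_ge0.
have pw0 (x : \bar R) c : 0 <= x `^ c by exact: poweR_ge0.
rewrite rV_fubini1//; last exact: measurable_fun_poweR.
have le_t t : \int[mu n.+1]_y (u (rV_cons (t, y)) `^ (1 + a)) <=
    (\int[mu n.+1]_y G y) `^ a * \prod_(i < n.+1) h i t `^ a.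
  rewrite muleC; apply: le_trans (IH _ _ _ (gagliardo_slice t ug) mG G0).
  have mut := measurable_rV_cons_slice t mu0.
  apply: ge0_le_integral => //.
  - exact: measurable_fun_poweR.
  - by apply: emeasurable_funM => //; exact: measurable_fun_poweR.
  move=> y _; rewrite poweRD ?add_neq0_poweRD_def ?gt_eqF ?addr_gt0//.
  rewrite poweRe1//; apply: lee_wpmul2l => //.
  by apply: (gt0_ler_poweR (ltW a0)); rewrite ?in_itv/= ?leey ?andbT.
have mprod : measurable_fun setT (fun t => \prod_(i < n.+1) h i t `^ a).
  by apply: emeasurable_prod => i; exact: measurable_fun_poweR.
have prod0 t : 0 <= \prod_(i < n.+1) h i t `^ a by apply: prode_ge0.
apply: (@le_trans _ _ (\int[lebesgue_measure]_t
    ((\int[mu n.+1]_y G y) `^ a * \prod_(i < n.+1) h i t `^ a))).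
  apply: ge0_le_integral => //.
  - by move=> t _; exact: integral_ge0.
  - apply: (measurable_rV_fubini1 (f := fun x => u x `^ (1 + a))) => //.
    exact: measurable_fun_poweR.
  - exact: measurable_funeM.
rewrite ge0_integralZl// big_ord_recl.
(* By Tonelli's theorem, the total mass of [G] is that of [g ord0]; this supplies the factor of
   index 0. *)
have <- : \int[mu n.+1]_y G y = \int[mu n.+2]_x g ord0 x by rewrite [RHS]rV_fubini2.
apply: lee_wpmul2l => //.
(* There are [n+1] factors with exponent [1/(n+1)], so the exponents add up to 1. *)
apply: le_trans (ereal_hoelder_prod _ mh h0) _.
rewrite le_eqVlt; apply/orP; left; apply/eqP; apply: eq_bigr => i _.
by rewrite [in RHS]rV_fubini1.
Qed.

(** The other half of the induction: the direct form implies the dual one in the same dimension, by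
    Hölder's inequality with weights [c = (n+1)/(n+2)] and [1/(n+2)]. The power [1 + 1/(n+1)] is the
    inverse of [c]. *)
Lemma gagliardo_dualS n u g v :
  @gagliardo_hyp n.+2 u g -> measurable_fun setT v -> (forall x, 0 <= v x) ->
  \int[mu n.+2]_x (u x `^ (1 + n.+1%:R^-1)) <=
    \prod_(i < n.+2) (\int[mu n.+2]_x g i x) `^ n.+1%:R^-1 ->
  \int[mu n.+2]_x (u x * v x `^ n.+2%:R^-1) <=
    \prod_(i < n.+2) (\int[mu n.+2]_x g i x) `^ n.+2%:R^-1 *
      (\int[mu n.+2]_x v x) `^ n.+2%:R^-1.
Proof.
case=> mu0 u0 mg g0 _ mv v0 main.
pose c : R := (n.+1%:R / n.+2%:R)%R.
have c0 : (0 < c)%R by rewrite divr_gt0.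
have cE : (c + n.+2%:R^-1 = 1)%R.
  by rewrite /c -[X in (_ + X)%R]mul1r -mulrDl natr1 divff// pnatr_eq0.
have n1 : (n.+1%:R != 0 :> R)%R by rewrite pnatr_eq0.
have n2 : (n.+2%:R != 0 :> R)%R by rewrite pnatr_eq0.
have uE x : u x = (u x `^ (1 + n.+1%:R^-1)) `^ c.
  rewrite -poweRrM [X in _ `^ X](_ : _ = 1%R) ?poweRe1//.
  rewrite /c mulrDl mul1r (mulrA (n.+1%:R^-1)%R) mulVf// mul1r.
  by rewrite -[X in (_ + X)%R]mul1r -mulrDl natr1 divff.
under eq_integral do rewrite uE.
have := @ereal_hoelder_pos _ _ _ (mu n.+2) (fun x => u x `^ (1 + n.+1%:R^-1)) v
  c (n.+2%:R^-1)%R.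
move=> /(_ (measurable_fun_poweR _ mu0) mv (fun x => poweR_ge0 _ _) v0 c0).
rewrite invr_gt0 ltr0n => /(_ isT cE) /le_trans; apply.
apply: lee_wpmul2r; first exact: poweR_ge0.
apply: (@le_trans _ _ ((\prod_(i < n.+2) (\int[mu n.+2]_x g i x) `^ n.+1%:R^-1) `^ c)).
  apply: (gt0_ler_poweR (ltW c0)) => //; rewrite ?in_itv/= ?leey ?andbT.
  - by apply: integral_ge0 => x _; exact: poweR_ge0.
  - by apply: prode_ge0 => i _; exact: poweR_ge0.
rewrite poweR_prod; last by move=> i; exact: poweR_ge0.
rewrite le_eqVlt; apply/orP; left; apply/eqP; apply: eq_bigr => i _.
by rewrite -poweRrM /c mulrA mulVf// mul1r.
Qed.

(** Each induction step goes from the dual form through the direct form one dimension higher to the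
    dual form there. It starts in dimension 1, where all exponents are 1. *)
Lemma gagliardo_dual n u g v : @gagliardo_hyp n.+1 u g ->
  measurable_fun setT v -> (forall x, 0 <= v x) ->
  \int[mu n.+1]_x (u x * v x `^ n.+1%:R^-1) <=
  \prod_(i < n.+1) (\int[mu n.+1]_x g i x) `^ n.+1%:R^-1 *
    (\int[mu n.+1]_x v x) `^ n.+1%:R^-1.
Proof.
elim: n u g v => [|n IH] u g v ug mv v0; last first.
  by apply: gagliardo_dualS => //; exact: gagliardo_step.
have [_ _ _ g0 _] := ug.
rewrite big_ord1 invr1 !poweRe1; try by apply: integral_ge0.
under eq_integral do rewrite poweRe1//.
exact: gagliardo_dual1.
Qed.

(** In terms of the dimension [N = n+2], the exponents are [N/(N-1)] and [1/(N-1)]. *)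
Lemma gagliardo n u g : @gagliardo_hyp n.+2 u g ->
  \int[mu n.+2]_x (u x `^ (1 + n.+1%:R^-1)) <=
    \prod_(i < n.+2) (\int[mu n.+2]_x g i x) `^ n.+1%:R^-1.
Proof. by apply: gagliardo_step => *; exact: gagliardo_dual. Qed.

End gagliardo.

(** * Borel sets and lines in R^n *)

Section rV_borel.
Context (R : realType) (n : nat).
Implicit Types (x y : 'rV[R]_n).

Lemma measurable_rV_cube (A : 'I_n -> set (measurableTypeR R)) :
  (forall i, measurable (A i)) ->
  measurable [set x : 'rV[R]_n | forall i, A i (x ord0 i)].
Proof.
move=> mA.
rewrite (_ : [set _ | _] = \big[setI/setT]_(i < n) (@rV_coord R n i @^-1` A i)).
  apply: bigsetI_measurable => i _; rewrite -[X in measurable X]setTI.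
  exact: measurable_rV_coord.
apply/seteqP; split => x /=.
  by rewrite -bigcap_seq => H i _; exact: H.
by rewrite -bigcap_seq => H i; apply: (H i); rewrite /= mem_index_enum.
Qed.

(** The sigma-algebra comes from the coordinates, not from the topology. An open set is the union of
    the cubes with rational centre and half-width [1/(k+1)] that it contains, and there are
    countably many of these. *)
Lemma open_measurable_rV (U : set 'rV[R]_n) : open U -> measurable U.
Proof.
move=> oU.
pose e k : R := k.+1%:R^-1.
pose B (p : 'rV[rat]_n * nat) : set 'rV[R]_n :=
  [set x | forall i, `]ratr (p.1 ord0 i) - e p.2, ratr (p.1 ord0 i) + e p.2[%classic
     (x ord0 i)].
have -> : U = \bigcup_p (if pselect (B p `<=` U) then B p else set0).
  apply/seteqP; split => [x Ux|x [p _]]; last by case: pselect => // BU; exact: BU.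
  move: oU; rewrite openE => /(_ _ Ux) /nbhs_ballP[/= r r0 xrU].
  (* Two points of a cube of half-width [e k] are less than [e k + e k] apart in the sup norm, so
     such a cube around [x] stays in the ball of radius [r]. *)
  have [k kr] : exists k, e k + e k < r.
    have r20 : 0 < r / 2 by rewrite divr_gt0.
    have := near_infty_natSinv_lt (PosNum r20) => -[k _ /(_ k (leqnn k)) /= kr].
    by exists k; rewrite /e [ltRHS]splitr ltrD.
  have e0 : 0 < e k by rewrite invr_gt0.
  have /choice[c cP] : forall i : 'I_n, exists q : rat,
      x ord0 i - e k < ratr q < x ord0 i + e k.
    move=> i; have /rat_in_itvoo[q] : x ord0 i - e k < x ord0 i + e k.
      by rewrite ltrBlDr -addrA ltrDl addr_gt0.
    by rewrite in_itv/= => ?; exists q.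
  have Bx y : B (\row_i c i, k) y -> U y.
    move=> By; apply: xrU; split => // i j; rewrite (ord1 i) {i}.
    move: (By j); rewrite /= mxE in_itv/= => /andP[y1 y2].
    have /andP[c1 c2] := cP j.
    rewrite /ball/= ltr_norml; apply/andP; split; move: kr y1 y2 c1 c2; lra.
  exists (\row_i c i, k) => //; case: pselect => // _ i.
  rewrite /B /= mxE in_itv/=; have /andP[c1 c2] := cP i.
  by apply/andP; split; move: c1 c2; lra.
apply: (@countable_bigcupT_measurable _ _ _
  (fun p => if pselect (B p `<=` U) then B p else set0)); first exact: countableP.
move=> p /=; case: (pselect (B p `<=` U)) => [BU|BU] /=; last exact: measurable0.
apply: (@measurable_rV_cube
  (fun i => `]ratr (p.1 ord0 i) - e p.2, ratr (p.1 ord0 i) + e p.2[%classic)) => i.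
exact: measurable_itv.
Qed.

Lemma continuous_measurable_rV (f : 'rV[R]_n -> R) :
  continuous f -> measurable_fun setT f.
Proof.
move=> /continuousP cf; apply: (measurability _ (RGenOpens.measurableE R)).
move=> _ [_ [a [b ->] <-]]; rewrite setTI; apply: open_measurable_rV.
exact/cf/interval_open.
Qed.

End rV_borel.

(** * Continuity and derivative of powers of the absolute value *)

Section norm_power.
Context (R : realType).
Implicit Types (s a x y z : R).

(** This form removes the absolute value: away from 0, regularity reduces to that of a real power at
    a positive point. *)
Lemma powR_norm_sqr a y : `|y| `^ a = (y ^+ 2) `^ (a / 2).
Proof.
rewrite -real_normK ?num_real// -powR_mulrn// -powRrM.
by rewrite mulrCA mulfV ?mulr1// pnatr_eq0.
Qed.

Lemma continuous_norm_powR a : 0 < a -> continuous (fun y => `|y| `^ a).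
Proof.
move=> a0 y; have [->|y0] := eqVneq y 0.
  rewrite /continuous_at normr0 powR0 ?gt_eqF//.
  apply/cvgrPdist_lt => e e0; near=> z.
  rewrite sub0r normrN ger0_norm ?powR_ge0//.
  rewrite -[ltRHS]powRr1 ?ltW// -(mulVf (lt0r_neq0 a0)) powRrM.
  apply: gt0_ltr_powR; rewrite ?nnegrE ?powR_ge0 ?invr_gt0//.
  near: z; exists (e `^ a^-1) => /=; first exact: powR_gt0.
  by move=> w /=; rewrite sub0r normrN.
under eq_fun do rewrite powR_norm_sqr.
have y20 : 0 < y ^+ 2 by rewrite exprn_even_gt0.
apply: (@continuous_comp _ _ _ (fun z : R => z ^+ 2) (fun z => z `^ (a / 2))).
  exact: exprn_continuous.
apply/differentiable_continuous/derivable1_diffP.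
by apply: derivable_powR; rewrite in_itv/= andbT.
Unshelve. all: by end_near. Qed.

(** The derivative is written without the sign of [y]. As [s - 2] is positive, it is a product of
    continuous functions, as the fundamental theorem of calculus requires later. *)
Lemma is_derive_norm_powR s y : 2 < s ->
  is_derive y 1 (fun z => `|z| `^ s) (s * `|y| `^ (s - 2) * y).
Proof.
move=> s2; have [->|y0] := eqVneq y 0; last first.
  under eq_fun do rewrite powR_norm_sqr.
  have y20 : 0 < y ^+ 2 by rewrite exprn_even_gt0.
  have d2 : is_derive y 1 (fun z : R => z ^+ 2) (y + y).
    rewrite (_ : (fun z => _) = (fun z : R => z) * (fun z : R => z)); last first.
      by apply/funext => z; rewrite expr2.
    have := is_deriveM (is_derive_id y 1) (is_derive_id y 1).
    by move/is_derive_eq; apply; rewrite /GRing.scale/= mulr1.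
  have h := @is_derive1_comp _ (fun z : R => z `^ (s / 2)) (fun z : R => z ^+ 2) y _ _
    (is_derive1_powR (s / 2) y20) d2.
  apply: is_derive_eq h _.
  rewrite powR_norm_sqr (_ : (s - 2) / 2 = s / 2 - 1); last by field.
  by field.
have h : is_derive (0 : R) 1 (fun z : R => `|z| `^ s) 0; last first.
  by apply: (is_derive_eq h); rewrite [RHS]mulr0.
(* At 0 the slope function is explicit, because [|z|^s] is [|z|^(s-2) z] times [z]. *)
apply/is_derive1_caratheodory; exists (fun z => `|z| `^ (s - 2) * z); split.
- move=> z; rewrite normr0 powR0 ?gt_eqF//; last by apply: lt_trans s2.
  rewrite !subr0 -mulrA -expr2 -[z ^+ 2]ger0_norm ?sqr_ge0// normrX.
  rewrite -[`|z| ^+ 2]powR_mulrn// -powRD ?subrK//.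
  by rewrite gt_eqF// (lt_trans _ s2).
- apply: cvgM; last exact: cvg_id.
  by apply: continuous_norm_powR; rewrite subr_gt0.
- by rewrite mulr0.
Qed.

End norm_power.

(** * Pointwise bound by an integral along a line *)

Section line_bound.
Context (R : realType).
Notation leb := (@lebesgue_measure R).

(** The fundamental theorem of calculus for [|f|^s] between the zero [b] and [t], followed by taking
    absolute values and enlarging the interval to the line. *)
Lemma norm_powR_le_integral (s : R) (f df : R -> R) (b t : R) : 2 < s ->
  (forall r : R, is_derive r 1 f (df r)) -> continuous df -> b < t -> f b = 0 ->
  ((`|f t| `^ s)%:E <= \int[leb]_r (s * `|f r| `^ (s - 1) * `|df r|)%:E)%E.
Proof.
move=> s2 dfE cdf bt fb0.
have s0 : 0 < s by apply: lt_trans s2.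
have cf : continuous f.
  move=> r; apply/differentiable_continuous/derivable1_diffP.
  exact: (@ex_derive _ _ _ _ _ _ _ (dfE r)).
have dF (r : R) :
    is_derive r 1 (fun r => `|f r| `^ s) (s * `|f r| `^ (s - 2) * f r * df r).
  exact: (@is_derive1_comp _ (fun y => `|y| `^ s) f r _ _ (is_derive_norm_powR (f r) s2)).
pose h r := s * `|f r| `^ (s - 2) * f r * df r.
have ch : continuous h.
  move=> r; apply: cvgM; last exact: cdf.
  apply: cvgM; last exact: cf.
  apply: cvgM; first exact: cvg_cst.
  apply: (@continuous_comp _ _ _ f (fun y => `|y| `^ (s - 2))); first exact: cf.
  by apply: continuous_norm_powR; rewrite subr_gt0.
have cF : continuous (fun r => `|f r| `^ s).
  move=> r; apply: (@continuous_comp _ _ _ f (fun y => `|y| `^ s)); first exact: cf.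
  exact: continuous_norm_powR.
have FTC : (\int[leb]_(r in `[b, t]) (h r)%:E = (`|f t| `^ s)%:E)%E.
  rewrite (@continuous_FTC2 _ h (fun r => `|f r| `^ s))//.
  - by rewrite fb0 normr0 powR0 ?gt_eqF// sube0.
  - exact: continuous_subspaceT.
  - split; first by move=> r _; exact: (@ex_derive _ _ _ _ _ _ _ (dF r)).
      by apply: cvg_at_right_filter; exact: cF.
    by apply: cvg_at_left_filter; exact: cF.
  - by move=> r _; rewrite derive1E (@derive_val _ _ _ _ _ _ _ (dF r)).
have hE r : `|h r| = s * `|f r| `^ (s - 1) * `|df r|.
  rewrite /h !normrM (ger0_norm (ltW s0)) (ger0_norm (powR_ge0 _ _)).
  congr (_ * _); rewrite -mulrA; congr (_ * _).
  rewrite -[X in _ * X]powRr1// -powRD; last first.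
    by apply/implyP => /eqP; lra.
  by congr (_ `^ _); lra.
have mh : measurable_fun setT h by exact: continuous_measurable_fun.
rewrite -FTC -[leLHS]gee0_abs; last by rewrite FTC lee_fin powR_ge0.
apply: le_trans (le_abse_integral _ _ _) _ => //.
  by apply/measurable_EFinP; exact: measurable_funTS.
under [leRHS]eq_integral do rewrite -hE.
apply: ge0_subset_integral => //.
by apply/measurable_EFinP; apply: measurableT_comp.
Qed.

End line_bound.

(** * Bounded sets and lines parallel to the axes *)

Section rV_lines.
Context (R : realType) (n : nat).
Implicit Types (x : 'rV[R]_n) (B : set 'rV[R]_n).
Local Notation mu := (lebesgue_rV R n).

Lemma coord_le_norm x i : `|x ord0 i| <= `|x|.
Proof.
rewrite [leRHS](mx_normrE x); apply/bigmax_geP; right => /=.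
by exists (ord0, i).
Qed.

Lemma bounded_set_gt0 (V : normedModType R) (B : set V) : bounded_set B ->
  exists2 M : R, 0 < M & forall y, B y -> `|y| <= M.
Proof. by move=> /pinfty_ex_gt0[M M0 BM]; exists M. Qed.

(** The set [Q] is an enclosing cube, whose measure is a finite product of lengths. *)
Lemma bounded_sub_finite_measure B : bounded_set B ->
  exists Q, [/\ measurable Q, B `<=` Q & (mu Q < +oo)%E].
Proof.
move=> /bounded_set_gt0[M M0 BM].
exists [set x : 'rV[R]_n | forall i, `[- M, M]%classic (x ord0 i)]; split.
- by apply: (@measurable_rV_cube _ _ (fun=> `[- M, M]%classic)) => i;
     exact: measurable_itv.
- move=> x /BM xM i; rewrite /= in_itv/= -ler_norml.
  exact: le_trans (coord_le_norm x i) xM.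
rewrite (lebesgue_rV_box (A := fun=> `[- M, M]%classic)); last first.
  by move=> i; exact: measurable_itv.
rewrite ltey_eq; apply/orP; left.
elim/big_ind : _ => [//|a b|i _]; first exact: fin_numM.
by rewrite lebesgue_measure_itv/=; case: ifPn.
Qed.

Lemma updE i r x : upd i r x = x + (r - x ord0 i) *: unit_vec R i.
Proof.
apply/rowP => j; rewrite !mxE eqxx /=; case: eqVneq => [->|_] /=.
  by rewrite mulr1 addrC subrK.
by rewrite mulr0 addr0.
Qed.

Lemma upd_id i x : upd i (x ord0 i) x = x.
Proof. by rewrite updE subrr scale0r addr0. Qed.

Lemma updD i r h x : upd i (h + r) x = h *: unit_vec R i + upd i r x.
Proof. by rewrite !updE addrCA -scalerDl addrA. Qed.

Lemma continuous_upd i x : continuous (fun r : R => upd i r x).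
Proof.
move=> r; under eq_fun do rewrite updE.
apply: cvgD; first exact: cvg_cst.
apply: cvgZr_tmp; apply: cvgB; [exact: cvg_id|exact: cvg_cst].
Qed.

(** By [updD], the difference quotient in [r] is the one that defines the directional derivative. *)
Lemma is_derive_upd (f : 'rV[R]_n -> R) i x (r : R) :
  derivable f (upd i r x) (unit_vec R i) ->
  is_derive r 1 (fun r => f (upd i r x)) (partial i f (upd i r x)).
Proof.
move=> df.
have E :
    (fun h : R => h^-1 *: (((fun r => f (upd i r x)) \o shift r) (h *: 1)
                           - f (upd i r x))) =
    (fun h : R => h^-1 *: ((f \o shift (upd i r x)) (h *: unit_vec R i) - f (upd i r x))).
  apply/funext => h; rewrite /= -updD; congr (_ *: (f (upd i (_ + r) x) - _)).
  by rewrite [LHS]mulr1.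
by split; rewrite /derivable /derive /partial E.
Qed.

End rV_lines.

(** * Sobolev's inequality for test functions *)

Section sobolev.
Context (R : realType).

Lemma lee_prod (I : Type) (r : seq I) (F G : I -> \bar R) :
  (forall i, 0 <= F i)%E -> (forall i, F i <= G i)%E ->
  (\prod_(i <- r) F i <= \prod_(i <- r) G i)%E.
Proof.
move=> F0 FG; elim: r => [|i r IH]; first by rewrite !big_nil.
by rewrite !big_cons lee_pmul//; apply: prode_ge0.
Qed.

(* Here a = \int |phi|^(2N/(N-2)) and d = \int |grad phi|^2; dividing by a^(1/2)
   leaves a to the power (N-1)/N - 1/2 = (N-2)/(2N). *)
Lemma sobolev_absorb (N s a d : R) : 2 < N -> 0 < s -> 0 <= a -> 0 <= d ->
  a <= (s * (a `^ 2^-1 * d `^ 2^-1)) `^ (N / (N - 1)) ->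
  a `^ (2 * N / (N - 2))^-1 <= s * d `^ 2^-1.
Proof.
move=> N2 s0; rewrite le_eqVlt => /predU1P[<-|a0] d0 h.
  rewrite powR0 ?mulr_ge0 ?powR_ge0 ?ltW//.
  by rewrite invr_neq0// mulf_neq0 ?invr_neq0//; apply/eqP; lra.
have e0 : 0 <= (N - 1) / N by apply: divr_ge0; lra.
(* Raising to the power [(N-1)/N] undoes the exponent on the right. *)
have := ge0_ler_powR e0 (ltW a0 : a \is Num.nneg) (powR_ge0 _ _ : _ \is Num.nneg) h.
rewrite -powRrM (_ : N / (N - 1) * ((N - 1) / N) = 1); last first.
  by field; apply/andP; split; apply/eqP; lra.
rewrite powRr1; last by rewrite !mulr_ge0 ?powR_ge0// ltW.
rewrite (_ : (N - 1) / N = (2 * N / (N - 2))^-1 + 2^-1); last first.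
  by field; apply/andP; split; apply/eqP; lra.
rewrite powRD; last by rewrite (gt_eqF a0) implybT.
by rewrite (mulrC (a `^ 2^-1)) mulrA ler_pM2r// powR_gt0.
Qed.

Variables (m : nat) (Omega : set 'rV[R]_m.+3).
Local Notation mu := (lebesgue_rV R m.+3).

Lemma sobolev_test (phi : 'rV[R]_m.+3 -> R) :
  let N : R := m.+3%:R in
  let p := 2 * N / (N - 2) in
  let s := 2 * (N - 1) / (N - 2) in
  measurable Omega -> test_function Omega phi ->
  ((\int[mu]_x (`|phi x| `^ p)%:E) `^ p^-1 <=
   s%:E * (\int[mu]_x (((fun x => \sum_i partial i phi x ^+ 2)
                         \_ Omega) x)%:E) `^ 2^-1)%E.
Proof.
move=> N p s mO [sphi [K [cK KO phi0]]].
have N3 : 3 <= N by rewrite /N ler_nat.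
have cphi : continuous phi by have [] := sphi [::].
have dphi x i : derivable phi x (unit_vec R i) by have [_] := sphi [::]; exact.
have cdphi i : continuous (partial i phi) by have [] := sphi [:: i].
have s2 : 2 < s by rewrite /s ltr_pdivlMr; lra.
have s0 : 0 < s by apply: lt_trans s2.
have p0 : 0 < p by apply: divr_gt0; lra.
(* This identity serves Cauchy-Schwarz, and [snp] serves Gagliardo's exponent [N/(N-1)]. *)
have s1p : (s - 1) = p / 2 by rewrite /s /p; field; apply/eqP; lra.
have snp : s * (1 + m.+2%:R^-1) = p.
  have -> : m.+2%:R = N - 1 by rewrite /N -[m.+3%:R]natr1 addrK.
  by rewrite /s /p; field; apply/andP; split; apply/eqP; lra.
have [M M0 KM] := bounded_set_gt0 (compact_bounded cK).
have mphi : measurable_fun setT phi by exact: continuous_measurable_rV.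
have mpw a : measurable_fun setT (fun x => `|phi x| `^ a).
  apply: (@measurableT_comp _ _ _ _ _ _ (@powR R ^~ a)) => //.
  exact: measurableT_comp.
pose u x := (`|phi x| `^ s)%:E.
pose g i x := (s * `|phi x| `^ (s - 1) * `|partial i phi x|)%:E.
have mg i : measurable_fun setT (g i).
  apply/measurable_EFinP; apply: measurable_funM.
    by apply: measurable_funM => //; exact: measurable_cst.
  by apply: measurableT_comp => //; exact: continuous_measurable_rV.
have g0 i x : (0 <= g i x)%E.
  by rewrite /g lee_fin mulr_ge0// mulr_ge0 ?powR_ge0// ltW.
have ug : gagliardo_hyp u g.
  split => //.
  - by apply/measurable_EFinP.
  - by move=> x; rewrite lee_fin powR_ge0.
  move=> i x; rewrite /u -[X in phi X](upd_id i x) /g.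
  (* This is to the left of [x ord0 i] and larger than [M] in absolute value, so the line has left
     [K] at parameter [b] and [phi] vanishes there. *)
  pose b := - (M + 1 + `|x ord0 i|).
  apply: (@norm_powR_le_integral _ s (fun r => phi (upd i r x))
            (fun r => partial i phi (upd i r x)) b) => //.
  - by move=> r; exact: is_derive_upd.
  - move=> r; apply: (@continuous_comp _ _ _ (fun r => upd i r x) (partial i phi)).
      exact: continuous_upd.
    exact: cdphi.
  - by rewrite /b; have := ler_norm (- x ord0 i); rewrite normrN; lra.
  apply: phi0 => /KM; apply/negP; rewrite -ltNge.
  apply: lt_le_trans (coord_le_norm _ i); rewrite mxE eqxx /b normrN ger0_norm.
    by have := normr_ge0 (x ord0 i); lra.
  by have := normr_ge0 (x ord0 i); lra.
have := gagliardo ug.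
under eq_integral do rewrite /u poweR_EFin -powRrM snp.
set A := (\int[mu]_x _)%E => gag.
pose h x := (((fun x => \sum_i partial i phi x ^+ 2) \_ Omega) x)%:E.
rewrite -/(\int[mu]_x h x)%E.
have h0 x : (0 <= h x)%E.
  rewrite lee_fin patchE; case: ifP => // _; apply: sumr_ge0 => i _; exact: sqr_ge0.
have mh : measurable_fun setT h.
  apply/measurable_EFinP; apply/(measurable_restrictT _ mO); apply: measurable_funTS.
  apply: measurable_sum => i; apply: measurable_funX.
  exact: continuous_measurable_rV.
have A0 : (0 <= A)%E by apply: integral_ge0 => x _; rewrite lee_fin powR_ge0.
have D0 : (0 <= \int[mu]_x h x)%E by exact: integral_ge0.
have half0 : 0 < 2^-1 :> R by rewrite invr_gt0.
(* Cauchy-Schwarz, as Hölder's inequality with both weights [1/2], applied to [|phi|^p] and the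
   squared length of the gradient. *)
have gle i : (\int[mu]_x g i x <= s%:E * (A `^ 2^-1 * (\int[mu]_x h x) `^ 2^-1))%E.
  pose f x := (`|phi x| `^ p)%:E.
  have f0 x : (0 <= f x)%E by rewrite /f lee_fin powR_ge0.
  have mf : measurable_fun setT f by apply/measurable_EFinP.
  have mfh : measurable_fun setT (fun x => f x `^ 2^-1 * h x `^ 2^-1)%E.
    by apply: emeasurable_funM; exact: measurable_fun_poweR.
  have fh0 x : (0 <= f x `^ 2^-1 * h x `^ 2^-1)%E.
    by rewrite mule_ge0// poweR_ge0.
  have half2 : 2^-1 + 2^-1 = 1 :> R by lra.
  apply: (@le_trans _ _ (s%:E * \int[mu]_x (f x `^ 2^-1 * h x `^ 2^-1))%E); last first.
    apply: lee_wpmul2l; first by rewrite lee_fin ltW.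
    exact: ereal_hoelder_pos.
  rewrite -ge0_integralZl//; last by rewrite lee_fin ltW.
  apply: ge0_le_integral => //.
    exact: measurable_funeM.
  move=> x _; rewrite /g /f /h !poweR_EFin -EFinM lee_fin -mulrA ler_wpM2l ?(ltW s0)//.
  rewrite -powRrM s1p; case: (pselect (Omega x)) => Ox.
    rewrite patchE mem_set// powR12_sqrt; last first.
      by apply: sumr_ge0 => j _; exact: sqr_ge0.
    apply: ler_wpM2l; first exact: powR_ge0.
    rewrite -sqrtr_sqr ler_wsqrtr// (bigD1 i)//= lerDl.
    by apply: sumr_ge0 => j _; exact: sqr_ge0.
  (* Off [Omega] the restricted gradient is 0, but so is [|phi|] to the positive power [p/2]. *)
  rewrite phi0; last by move=> /KO.
  by rewrite normr0 powR0 ?mul0r// gt_eqF// divr_gt0.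
(* The absorption divides by a power of [A], which must therefore be finite: [phi] is bounded with
   compact support. *)
have Aoo : (A < +oo)%E.
  have [Q [mQ KQ Qoo]] := bounded_sub_finite_measure (compact_bounded cK).
  have /compact_bounded/bounded_set_gt0[B B0 KB] :
      compact (phi @` K).
    by apply: continuous_compact => //; exact: continuous_subspaceT.
  apply: (@le_lt_trans _ _ (\int[mu]_(x in Q) (B `^ p)%:E)%E).
    rewrite [leRHS]integral_mkcond; apply: ge0_le_integral => //.
    - by apply/measurable_EFinP.
    - by apply/(measurable_restrictT _ mQ); exact: measurable_cst.
    move=> x _; case: (pselect (K x)) => Kx.
      rewrite patchE mem_set; last exact: KQ.
      rewrite lee_fin; apply: ge0_ler_powR; rewrite ?nnegrE ?(ltW p0) ?(ltW B0)//.
      by apply: KB; exists x.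
    rewrite phi0// normr0 powR0 ?gt_eqF// patchE; case: ifP => // _.
    by rewrite lee_fin powR_ge0.
  by rewrite integral_cst// lte_mul_pinfty// lee_fin powR_ge0.
have [Doo|Dnoo] := eqVneq (\int[mu]_x h x)%E +oo%E.
  by rewrite Doo poweRyr ?gt_eqF// gt0_muley ?leey// lte_fin.
have [a aE] : exists a, A = a%:E by exists (fine A); rewrite fineK// ge0_fin_numE.
have [d dE] : exists d, (\int[mu]_x h x)%E = d%:E.
  by exists (fine (\int[mu]_x h x)%E); rewrite fineK// ge0_fin_numE// ltey.
move: gag A0 D0; rewrite aE dE => gag.
rewrite !poweR_EFin -EFinM !lee_fin => a0 d0.
apply: sobolev_absorb => //; first lra.
pose c := s * (a `^ 2^-1 * d `^ 2^-1).
have c0 : 0 <= c.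
  by rewrite /c mulr_ge0 ?(ltW s0)// mulr_ge0 ?powR_ge0.
(* All [N] integrals have the same bound [c], so the product is at most [c^(N/(N-1))]. *)
have : (a%:E <= \prod_(i < m.+3) (c `^ m.+2%:R^-1)%:E)%E.
  apply: le_trans gag _; apply: lee_prod => i; rewrite ?poweR_ge0//.
  rewrite -poweR_EFin; apply: gt0_ler_poweR; rewrite ?in_itv/= ?leey ?andbT//.
  - exact: integral_ge0.
  - by apply: le_trans (gle i) _; rewrite aE dE !poweR_EFin -!EFinM.
rewrite prodEFin prodr_const card_ord lee_fin -powR_mulrn ?powR_ge0// -powRrM.
have -> : m.+2%:R = N - 1 by rewrite /N -[m.+3%:R]natr1 addrK.
by rewrite mulrC.
Qed.

End sobolev.

(** * Passage to the limit *)

Section semicontinuity.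
Context d (T : measurableType d) (R : realType).
Variable mu : {measure set T -> \bar R}.

Lemma limn_einf_le_cst (w : (\bar R)^nat) (b : \bar R) :
  (forall k, w k <= b)%E -> (limn_einf w <= b)%E.
Proof.
move=> wb; rewrite limn_einf_lim; apply: lime_le; first exact: is_cvg_einfs.
near=> k; apply: le_trans (wb k); apply: ereal_inf_lbound.
by exists k => /=.
Unshelve. all: by end_near. Qed.

Lemma limn_einf_ge_near (w : (\bar R)^nat) (b : \bar R) :
  (\forall k \near \oo, b <= w k)%E -> (b <= limn_einf w)%E.
Proof.
move=> [N _ bw]; rewrite limn_einf_lim; apply: lime_ge; first exact: is_cvg_einfs.
exists N => // k /= Nk; apply: le_ereal_inf_tmp => _ [j /= kj <-].
by apply: bw => /=; exact: leq_trans kj.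
Qed.

(* The penalty k (y - z_k)^2 makes up for the absence of convergence of z: no
   extraction of an almost everywhere convergent subsequence is needed below. *)
Lemma norm_powR_le_limn_einf (p : R) (y : R) (z : R^nat) : 0 < p ->
  ((`|y| `^ p)%:E <=
   limn_einf (fun k => (`|z k| `^ p + k.+1%:R * (y - z k) ^+ 2)%:E))%E.
Proof.
move=> p0; apply/lee_addgt0Pr => e e0; rewrite -leeBlDr// -EFinB.
apply: limn_einf_ge_near.
(* If [z k] is within [D] of [y], continuity bounds the loss by [e]. Otherwise the penalty is at
   least [k D^2], which exceeds or equals [|y|^p] for large [k]. *)
have /cvgrPdist_lt/(_ e e0)/nbhs_ballP[D /= D0 HD] := @continuous_norm_powR _ _ p0 y.
have D20 : 0 < D ^+ 2 by rewrite exprn_gt0.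
have := nbhs_infty_ger (`|y| `^ p / D ^+ 2).
apply: filterS => k /=; rewrite ler_pdivrMr// => kD.
rewrite lee_fin; have [yz|yz] := ltP `|y - z k| D.
  have := HD (z k) yz => /ltW; rewrite ler_norml => /andP[_].
  have : 0 <= k.+1%:R * (y - z k) ^+ 2 by rewrite mulr_ge0// sqr_ge0.
  lra.
have : D ^+ 2 <= (y - z k) ^+ 2.
  by rewrite -[leRHS]real_normK ?num_real// lerXn2r ?nnegrE// ltW.
move=> Dyz; have z0 : 0 <= `|z k| `^ p by exact: powR_ge0.
have : k.+1%:R * D ^+ 2 <= k.+1%:R * (y - z k) ^+ 2 by rewrite ler_wpM2l.
have : k%:R * D ^+ 2 <= k.+1%:R * D ^+ 2.
  by apply: ler_wpM2r; rewrite ?ler_nat// ltW.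
lra.
Qed.

(** Fatou's lemma for the penalized integrands. Choosing [f k] with squared distance to [v] at most
    [e/(k+1)] keeps the integral of the penalty below [e]. *)
Lemma integral_norm_powR_lsc (p : R) (B : \bar R) (v : T -> R) :
  0 < p -> measurable_fun setT v ->
  (forall e : R, 0 < e -> exists f : T -> R, [/\ measurable_fun setT f,
     (\int[mu]_x (`|f x| `^ p)%:E <= B)%E &
     (\int[mu]_x ((v x - f x) ^+ 2)%:E <= e%:E)%E]) ->
  (\int[mu]_x (`|v x| `^ p)%:E <= B)%E.
Proof.
move=> p0 mv H; apply/lee_addgt0Pr => e e0.
have /choice[f fP] : forall k : nat, exists f : T -> R, [/\ measurable_fun setT f,
     (\int[mu]_x (`|f x| `^ p)%:E <= B)%E &
     (\int[mu]_x ((v x - f x) ^+ 2)%:E <= (e / k.+1%:R)%:E)%E].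
  by move=> k; apply: H; rewrite divr_gt0.
have mpw (g : T -> R) : measurable_fun setT g ->
    measurable_fun setT (fun x => (`|g x| `^ p)%:E).
  move=> mg; apply/measurable_EFinP.
  apply: (@measurableT_comp _ _ _ _ _ _ (@powR R ^~ p)) => //.
  exact: measurableT_comp.
have msq k : measurable_fun setT (fun x => ((v x - f k x) ^+ 2)%:E).
  have [mf _ _] := fP k; apply/measurable_EFinP; apply: measurable_funX.
  exact: measurable_funB.
pose F k x := (`|f k x| `^ p + k.+1%:R * (v x - f k x) ^+ 2)%:E.
have FE k x : F k x = ((`|f k x| `^ p)%:E + k.+1%:R%:E * ((v x - f k x) ^+ 2)%:E)%E by [].
have mF k : measurable_fun setT (F k).
  have [mf _ _] := fP k; rewrite (funext (FE k)).
  by apply: emeasurable_funD; [exact: mpw|exact: measurable_funeM].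
have F0 k x : (0 <= F k x)%E.
  by rewrite lee_fin addr_ge0 ?powR_ge0// mulr_ge0// sqr_ge0.
apply: (@le_trans _ _ (\int[mu]_x limn_einf (F ^~ x))%E).
  apply: ge0_le_integral => //.
  - exact: mpw.
  - apply: measurableT_comp => //.
    apply: (measurable_fun_limn_esup (f := fun k x => - F k x)%E) => k.
    exact: measurableT_comp.
  - by move=> x _; exact: norm_powR_le_limn_einf.
apply: le_trans (fatou _ _ _ _) _ => //.
apply: limn_einf_le_cst => k; have [mf fB fe] := fP k.
under eq_integral do rewrite FE.
rewrite ge0_integralD//; last 3 first.
- exact: mpw.
- by move=> x _; rewrite mule_ge0// lee_fin sqr_ge0.
- exact: measurable_funeM.
apply: leeD => //; rewrite ge0_integralZl//; last first.
  by move=> x _; rewrite lee_fin sqr_ge0.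
apply: le_trans (lee_wpmul2l _ fe) _ => //.
by rewrite -EFinM lee_fin mulrCA mulfV ?mulr1// pnatr_eq0.
Qed.

End semicontinuity.

(** * Lebesgue norms on a bounded set *)

Section Lq_norms.
Context (R : realType) (n : nat) (Omega : set 'rV[R]_n).
Local Notation mu := (lebesgue_rV R n).
Implicit Types (u : 'rV[R]_n -> R) (G : 'rV[R]_n -> 'rV[R]_n) (p q : R).

Lemma Lq_normE q u :
  Lq_norm Omega q u = ((\int[mu]_x (`|(u \_ Omega) x| `^ q)%:E) `^ q^-1)%E.
Proof. by rewrite /Lq_norm unlock. Qed.

Lemma Lq_measurable q u : Lq Omega q u -> measurable_fun setT (u \_ Omega).
Proof. by move=> /sub_Lfun_mfun; rewrite inE. Qed.

Lemma Lq_norm2_sqr u :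
  (Lq_norm Omega 2 u `^ 2 = \int[mu]_x (((u \_ Omega) x) ^+ 2)%:E)%E.
Proof.
rewrite /Lq_norm poweR_Lnorm; last by rewrite pnatr_eq0.
apply: eq_integral => x _ /=.
by rewrite powR_mulrn// real_normK// num_real.
Qed.

Lemma Lq_norm2_euclid G :
  (Lq_norm Omega 2 (fun x => euclid_norm (G x)) `^ 2 =
   \int[mu]_x (((fun x => \sum_i G x ord0 i ^+ 2) \_ Omega) x)%:E)%E.
Proof.
rewrite Lq_norm2_sqr; apply: eq_integral => x _; congr (_%:E).
rewrite !patchE; case: ifP => _; last by rewrite expr0n.
by rewrite sqr_sqrtr//; apply: sumr_ge0 => i _; exact: sqr_ge0.
Qed.

(** Hölder's inequality with weights [p/q] and [1 - p/q] for [|u|^q] and the indicator of an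
    enclosing set [Q]. Nothing forces [p] to be at least 1. *)
Lemma Lq_norm_embedding p q : bounded_set Omega -> 0 < p -> p < q ->
  exists2 C : R, 0 < C & forall u, measurable_fun setT (u \_ Omega) ->
    (Lq_norm Omega p u <= C%:E * Lq_norm Omega q u)%E.
Proof.
move=> bO p0 pq; have q0 : 0 < q by exact: lt_trans pq.
have [Q [mQ OQ Qoo]] := bounded_sub_finite_measure bO.
have Qfin : mu Q \is a fin_num by rewrite ge0_fin_numE.
pose b := 1 - p / q.
have b0 : 0 < b by rewrite subr_gt0 ltr_pdivrMr// mul1r.
have a0 : 0 < p / q by rewrite divr_gt0.
(* The added 1 makes the constant positive even if [Q] is a null set. *)
pose C := (fine (mu Q) `^ b) `^ p^-1 + 1.
have C0 : 0 < C by rewrite ltr_wpDl// powR_ge0.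
exists C => // u mu0.
pose f x := (`|(u \_ Omega) x| `^ q)%:E.
have mf : measurable_fun setT f.
  apply/measurable_EFinP.
  apply: (@measurableT_comp _ _ _ _ _ _ (@powR R ^~ q)) => //.
  exact: measurableT_comp.
have f0 x : (0 <= f x)%E by rewrite lee_fin powR_ge0.
pose g x : \bar R := (\1_Q x)%:E.
have mg : measurable_fun setT g by apply/measurable_EFinP; exact: measurable_indic.
have g0 x : (0 <= g x)%E by rewrite lee_fin.
have hold := ereal_hoelder_pos mu mf mg f0 g0 a0 b0 (subrKC _ _).
have E : (\int[mu]_x (`|(u \_ Omega) x| `^ p)%:E =
    \int[mu]_x (f x `^ (p / q) * g x `^ b))%E.
  apply: eq_integral => x _; rewrite /f /g !poweR_EFin -EFinM; congr (_%:E).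
  rewrite -powRrM mulrCA mulfV ?mulr1 ?gt_eqF// indicE.
  case: (pselect (Omega x)) => Ox.
    by rewrite [x \in Q]mem_set ?powR1 ?mulr1//; exact: OQ.
  by rewrite patchE memNset// normr0 powR0 ?mul0r// gt_eqF.
have If0 : (0 <= \int[mu]_x f x)%E by exact: integral_ge0.
rewrite !Lq_normE E.
have pV0 : 0 <= p^-1 by rewrite invr_ge0 ltW.
apply: (@le_trans _ _ (((\int[mu]_x f x) `^ (p / q) * (\int[mu]_x g x) `^ b) `^ p^-1)%E).
  apply: gt0_ler_poweR => //; rewrite ?in_itv/= ?leey ?andbT.
  - by apply: integral_ge0 => x _; rewrite mule_ge0// poweR_ge0.
  - by rewrite mule_ge0// poweR_ge0.
rewrite poweRM ?poweR_ge0// -poweRrM mulrAC mulfV ?gt_eqF// mul1r muleC.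
apply: lee_wpmul2r; first exact: poweR_ge0.
have -> : (\int[mu]_x g x)%E = (fine (mu Q))%:E.
  by rewrite /g integral_indic// setIT; exact/esym/fineK.
rewrite !poweR_EFin lee_fin /C.
by rewrite lerDl.
Qed.

End Lq_norms.

(** * Sobolev's inequality by density *)

Section sobolev_H10.
Context (R : realType) (m : nat) (Omega : set 'rV[R]_m.+3).
Local Notation mu := (lebesgue_rV R m.+3).
Local Notation N := (m.+3%:R : R).
Implicit Types (u : 'rV[R]_m.+3 -> R) (G : 'rV[R]_m.+3 -> 'rV[R]_m.+3).

Lemma H1_norm_lt u G (e : R) : 0 <= e -> (H1_norm Omega u G < e%:E)%E ->
  (Lq_norm Omega 2 u `^ 2 <= (e ^+ 2)%:E)%E /\
  (Lq_norm Omega 2 (fun x => euclid_norm (G x)) `^ 2 <= (e ^+ 2)%:E)%E.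
Proof.
move=> e0; rewrite /H1_norm.
set a := (Lq_norm _ _ u `^ _)%E; set b := (_ `^ 2)%E => /ltW lte.
have a0 : (0 <= a)%E by exact: poweR_ge0.
have b0 : (0 <= b)%E by exact: poweR_ge0.
have : (a + b <= (e ^+ 2)%:E)%E.
  rewrite -[leLHS]poweRe1 ?adde_ge0// -(mulVf (lt0r_neq0 (ltr0Sn R 1))) poweRrM.
  rewrite -(powR_mulrn _ e0) -poweR_EFin.
  by apply: (gt0_ler_poweR (ler0n R 2)); rewrite ?in_itv/= ?leey ?andbT ?poweR_ge0.
by split; [apply: le_trans (leeDl a b0) _|apply: le_trans (leeDr b a0) _].
Qed.

Lemma measurable_sqr_restrict G : measurable Omega ->
  (forall i, measurable_fun setT ((fun x => G x ord0 i) \_ Omega)) ->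
  measurable_fun setT (EFin \o ((fun x => \sum_i G x ord0 i ^+ 2) \_ Omega)).
Proof.
move=> mO mG; apply/measurable_EFinP/(measurable_restrictT _ mO).
apply: measurable_sum => i; apply: measurable_funX.
exact/(measurable_restrictT _ mO).
Qed.

(** The factor [sqrt 2] is the price of comparing gradients through squares, with
    [|b|^2 <= 2 (|a|^2 + |a - b|^2)], instead of the triangle inequality for the norm. *)
Lemma sobolev_H10 u G : let s : R := 2 * (N - 1) / (N - 2) in
  measurable Omega -> H10 Omega u G ->
  (Lq_norm Omega (2 * N / (N - 2)) u <=
   (s * Num.sqrt 2)%:E * Lq_norm Omega 2 (fun x => euclid_norm (G x)))%E.
Proof.
move=> s mO [[Lu LG _] approx].
have N3 : 3 <= N by rewrite ler_nat.
have s0 : 0 < s by rewrite divr_gt0 ?mulr_gt0//; lra.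
have p0 : 0 < 2 * N / (N - 2) by rewrite divr_gt0 ?mulr_gt0//; lra.
pose p := 2 * N / (N - 2); rewrite -/p in p0 *.
have mu0 := Lq_measurable Lu.
have mG i := Lq_measurable (LG i).
pose sq (H : 'rV[R]_m.+3 -> 'rV[R]_m.+3) x : \bar R :=
  (((fun x => \sum_i H x ord0 i ^+ 2) \_ Omega) x)%:E.
have sq0 H x : (0 <= sq H x)%E.
  rewrite /sq lee_fin patchE; case: ifP => // _.
  by apply: sumr_ge0 => i _; exact: sqr_ge0.
pose D := (\int[mu]_x sq G x)%E.
have D0 : (0 <= D)%E by exact: integral_ge0.
have DE : (Lq_norm Omega 2 (fun x => euclid_norm (G x)) = D `^ 2^-1)%E.
  rewrite /D -Lq_norm2_euclid -poweRrM mulfV ?pnatr_eq0// poweRe1//.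
  exact: Lnorm_ge0.
have key (eta : R) : 0 < eta ->
    (Lq_norm Omega p u <= s%:E * (2%:E * (D + eta%:E)) `^ 2^-1)%E.
  move=> eta0; rewrite Lq_normE.
  set B := (s%:E * _)%E.
  have De0 : (0 <= 2%:E * (D + eta%:E))%E by rewrite mule_ge0// adde_ge0// lee_fin ltW.
  have B0 : (0 <= B)%E by rewrite mule_ge0 ?poweR_ge0// lee_fin ltW.
  suff H : (\int[mu]_x (`|(u \_ Omega) x| `^ p)%:E <= B `^ p)%E.
    rewrite -(poweRe1 B0) -(mulfV (lt0r_neq0 p0)) poweRrM.
    apply: gt0_ler_poweR => //; rewrite ?in_itv/= ?leey ?andbT ?poweR_ge0//.
    - by rewrite invr_ge0 ltW.
    - by apply: integral_ge0 => x _; rewrite lee_fin powR_ge0.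
  apply: integral_norm_powR_lsc => // e e0.
  (* The square of [d] is at most [e], for the distance between [u] and [phi], and at most [eta],
     for the error on the gradient. *)
  pose d := Num.sqrt (Num.min e eta).
  have m0 : 0 < Num.min e eta by rewrite lt_min e0.
  have d0 : 0 < d by rewrite sqrtr_gt0.
  have d2 : d ^+ 2 = Num.min e eta by rewrite sqr_sqrtr// ltW.
  have [phi [tphi /(H1_norm_lt (ltW d0))]] := approx d d0.
  rewrite d2 Lq_norm2_sqr Lq_norm2_euclid => -[ue Ge].
  have [sphi [K [cK KO phi0]]] := tphi.
  have cphi : continuous phi by have [] := sphi [::].
  exists phi; split; first exact: continuous_measurable_rV.
  - have := sobolev_test mO tphi; rewrite -/N -/s -/p.
    rewrite (_ : (fun x => \sum_i partial i phi x ^+ 2) =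
      (fun x => \sum_i (gradient phi x) ord0 i ^+ 2)); last first.
      by apply/funext => x; apply: eq_bigr => i _; rewrite mxE.
    rewrite -/(sq (gradient phi)) => sob.
    have A0 : (0 <= \int[mu]_x (`|phi x| `^ p)%:E)%E.
      by apply: integral_ge0 => x _; rewrite lee_fin powR_ge0.
    rewrite -[leLHS](poweRe1 A0) -(mulVf (lt0r_neq0 p0)) poweRrM.
    apply: (gt0_ler_poweR (ltW p0)); rewrite ?in_itv/= ?leey ?andbT ?poweR_ge0//.
    apply: le_trans sob _; apply: lee_wpmul2l; first by rewrite lee_fin ltW.
    have half0 : 0 <= 2^-1 :> R by rewrite invr_ge0.
    have mgphi i : measurable_fun setT ((fun x => (gradient phi x) ord0 i) \_ Omega).
      apply/(measurable_restrictT _ mO); apply: measurable_funTS.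
      under eq_fun do rewrite mxE.
      by apply: continuous_measurable_rV; have [] := sphi [:: i].
    have mGphi i : measurable_fun setT
        ((fun x => (G x - gradient phi x) ord0 i) \_ Omega).
      apply/(measurable_restrictT _ mO).
      under eq_fun do rewrite mxE [in X in _ + X]mxE.
      by apply: measurable_funB; exact/(measurable_restrictT _ mO).
    have msq (H : 'rV[R]_m.+3 -> 'rV[R]_m.+3) :
      (forall i, measurable_fun setT ((fun x => H x ord0 i) \_ Omega)) ->
      measurable_fun setT (sq H) by exact: measurable_sqr_restrict.
    apply: (gt0_ler_poweR half0); rewrite ?in_itv/= ?leey ?andbT//.
      by apply: integral_ge0 => x _; exact: sq0.
    apply: (@le_trans _ _ (\int[mu]_x
        (2%:E * (sq G x + sq (fun x => G x - gradient phi x)%R x)))%E).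
      apply: ge0_le_integral => //.
      + by move=> x _; exact: sq0.
      + exact: msq.
      + by apply: measurable_funeM; apply: emeasurable_funD; exact: msq.
      move=> x _; rewrite /sq !patchE; case: ifP => _; last by rewrite !adde0 mule0.
      rewrite -EFinD -EFinM lee_fin -big_split mulr_sumr; apply: ler_sum => i _ /=.
      (* With [a] and [b] the two components, [2 (a^2 + (a-b)^2) - b^2] is the square of
         [2a - b]. *)
      rewrite !mxE; have := sqr_ge0 (G x ord0 i + (G x ord0 i - partial i phi x)); nra.
    rewrite ge0_integralZl//.
    + apply: lee_wpmul2l => //; rewrite ge0_integralD//; try exact: msq.
      rewrite leeD2l//; apply: le_trans Ge _.
      by rewrite lee_fin ge_min lexx orbT.
    + by apply: emeasurable_funD; exact: msq.
    + by move=> x _; rewrite adde_ge0.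
  - apply: (@le_trans _ _ (Num.min e eta)%:E); last first.
      by rewrite lee_fin ge_min lexx.
    apply: le_trans ue; rewrite le_eqVlt; apply/orP; left; apply/eqP.
    apply: eq_integral => x _; rewrite !patchE; case: ifP => // /negbT.
    by rewrite notin_setE => nOx; rewrite phi0 ?subr0// => /KO.
have [Doo|Dnoo] := eqVneq D +oo%E.
  rewrite DE Doo poweRyr ?invr_neq0 ?pnatr_eq0// gt0_muley ?leey//.
  by rewrite lte_fin mulr_gt0// sqrtr_gt0.
have [d dE] : exists d, D = d%:E by exists (fine D); rewrite fineK// ge0_fin_numE// ltey.
move: D0; rewrite DE dE lee_fin => d0.
have [a aE] : exists a, Lq_norm Omega p u = a%:E.
  exists (fine (Lq_norm Omega p u)); rewrite fineK// ge0_fin_numE; last exact: Lnorm_ge0.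
  apply: le_lt_trans (key 1 ltr01) _.
  by rewrite dE -EFinD -EFinM ltry.
have a0 : 0 <= a by rewrite -lee_fin -aE; exact: Lnorm_ge0.
rewrite aE poweR_EFin -EFinM lee_fin powR12_sqrt// -mulrA -sqrtrM//.
have s2 : 0 < 2 * s ^+ 2 by rewrite mulr_gt0// exprn_gt0.
have : a ^+ 2 <= s ^+ 2 * (2 * d).
  apply/ler_addgt0Pr => e e0.
  (* Chosen so that, after squaring, the error term is exactly [e]. *)
  have e1 : 0 < e / (2 * s ^+ 2) by rewrite divr_gt0.
  have := key _ e1; rewrite aE dE -EFinD -EFinM lee_fin.
  have de0 : 0 <= 2 * (d + e / (2 * s ^+ 2)) by rewrite mulr_ge0// addr_ge0// ltW.
  rewrite powR12_sqrt// => ae.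
  have : a ^+ 2 <= (s * Num.sqrt (2 * (d + e / (2 * s ^+ 2)))) ^+ 2.
    by rewrite lerXn2r// nnegrE// mulr_ge0 ?sqrtr_ge0// ltW.
  rewrite exprMn sqr_sqrtr// => /le_trans; apply.
  rewrite le_eqVlt; apply/orP; left; apply/eqP; field.
  by apply/eqP; lra.
move=> asd; rewrite -(ler_pXn2r (n := 2))// ?nnegrE//; last first.
  by rewrite mulr_ge0 ?sqrtr_ge0// ltW.
by rewrite exprMn sqr_sqrtr// mulr_ge0.
Qed.

End sobolev_H10.

(** * Comparison of the exponents and assembly of the chains *)

Theorem lemma4p4 (R : realType) (n : nat) (Omega : set 'rV[R]_n)
    (gamma sigma : R) :
  (3 <= n)%N ->
  bounded_domain Omega -> smooth_boundary Omega ->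
  0 < gamma < (n%:R + 2) / (n%:R - 2) ->
  0 < sigma < Num.min (1 / 3) ((n%:R + 2 - (n%:R - 2) * gamma) / 2) ->
  (exists C1 C2 : R, [/\ 0 < C1, 0 < C2 &
    forall u : 'rV[R]_n -> R,
      Lq Omega (2 * n%:R / (n%:R - 2 - 2 * sigma)) u ->
      (Lq_norm Omega 2 u
       <= C1%:E * Lq_norm Omega
            (2 * n%:R * (n%:R - 2)
             / (n%:R * (n%:R - 4 - 2 * sigma) + 4 * (1 + 3 * sigma))) u
       <= C2%:E * Lq_norm Omega (2 * n%:R / (n%:R - 2 - 2 * sigma)) u)%E]) /\
  (exists C1 C2 : R, [/\ 0 < C1, 0 < C2 &
    forall (u : 'rV[R]_n -> R) (gradu : 'rV[R]_n -> 'rV[R]_n),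
      H10 Omega u gradu ->
      (Lq_norm Omega (2 * n%:R * gamma / (n%:R + 2 - 2 * sigma)) u
       <= C1%:E * Lq_norm Omega (2 * n%:R / (n%:R - 2)) u
       <= C2%:E * Lq_norm Omega 2 (fun x => euclid_norm (gradu x)))%E]).
Proof.
case: n Omega => [|[|[|m]]]// Omega _ [_ oO _ bO] _.
have N3 : 3 <= m.+3%:R :> R by rewrite ler_nat.
set N : R := m.+3%:R in N3 *.
move=> /andP[g0 gN] /andP[s0]; rewrite lt_min => /andP[s13 sg].
rewrite ltr_pdivlMr in gN; last by lra.
rewrite ltr_pdivlMr in sg; last by lra.
have mO := open_measurable_rV oO.
pose q1 := 2 * N * (N - 2) / (N * (N - 4 - 2 * sigma) + 4 * (1 + 3 * sigma)).
pose q2 := 2 * N / (N - 2 - 2 * sigma).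
pose q3 := 2 * N * gamma / (N + 2 - 2 * sigma).
pose q4 := 2 * N / (N - 2).
(* This denominator equals [(N-2)^2 - 2 sigma (N-6)]. *)
have d1 : 0 < N * (N - 4 - 2 * sigma) + 4 * (1 + 3 * sigma) by nra.
have d2 : 0 < N - 2 - 2 * sigma by lra.
have d3 : 0 < N + 2 - 2 * sigma by lra.
have d4 : 0 < N - 2 by lra.
have d5 : 0 < N - 1 by lra.
(* It amounts to [sigma (6 - N) < N - 2], which for [N = 3] is exactly [sigma < 1/3]. *)
have q12 : 2 < q1 by rewrite /q1 ltr_pdivlMr//; nra.
(* After clearing denominators, the two sides differ by a positive multiple of [8 sigma]. *)
have q1q2 : q1 < q2.
  rewrite /q1 /q2 ltr_pdivrMr// [ltRHS]mulrAC ltr_pdivlMr//.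
  by rewrite -(mulrA (2 * N)) ltr_pM2l; nra.
have q30 : 0 < q3 by rewrite divr_gt0// !mulr_gt0//; lra.
(* This is the second bound on [sigma], in the form [(N-2) gamma < N + 2 - 2 sigma]. *)
have q3q4 : q3 < q4.
  rewrite /q3 /q4 ltr_pdivrMr// [ltRHS]mulrAC ltr_pdivlMr//.
  by rewrite -(mulrA (2 * N)) ltr_pM2l; nra.
split.
- have [C C0 HC] := Lq_norm_embedding bO (ltr0Sn R 1) q12.
  have [C' C'0 HC'] := Lq_norm_embedding bO (lt_trans (ltr0Sn R 1) q12) q1q2.
  (* The middle term of the chain carries the factor [C], so the last constant is a product. *)
  exists C, (C * C'); split; rewrite ?mulr_gt0// => u /Lq_measurable mu0.
  rewrite HC//= EFinM -muleA; apply: lee_wpmul2l; first by rewrite lee_fin ltW.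
  exact: HC'.
- have [C C0 HC] := Lq_norm_embedding bO q30 q3q4.
  pose S := 2 * (N - 1) / (N - 2) * Num.sqrt 2.
  have S0 : 0 < S by rewrite mulr_gt0 ?sqrtr_gt0// divr_gt0// mulr_gt0.
  exists C, (C * S); split => [//||u G uG]; first exact: mulr_gt0 C0 S0.
  have [[Lu _ _] _] := uG; rewrite HC//=; last exact: Lq_measurable Lu.
  rewrite EFinM -muleA; apply: lee_wpmul2l; first by rewrite lee_fin ltW.
  exact: sobolev_H10.
Qed.
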